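(* Let $X$ and $Y$ be Banach spaces. (a) The set of compact operators from $X$ to $Y$ which uniquely quasi attain their norm is dense in $\mathcal{K}(X,Y)$. (b) The set of weakly compact operators from $X$ to $Y$ which uniquely quasi attain their norm is dense in $\mathcal{W}(X,Y)$.
   Context: Banach spaces are over $\mathbb{K}=\mathbb{R}$ or $\mathbb{C}$; $\mathbb{T}=\{\theta\in\mathbb{K}:|\theta|=1\}$; $B_X$ is the closed unit ball of $X$. $\mathcal{K}(X,Y)$ and $\mathcal{W}(X,Y)$ are the spaces of compact and of weakly compact (bounded linear) operators from $X$ to $Y$, with the operator norm. A bounded linear operator $T\colon X\to Y$ uniquely quasi attains its norm if there is $u\in Y$ such that every sequence $(x_n)\subset B_X$ with $\|Tx_n\|\to\|T\|$ has a subsequence $(x_{\sigma(n)})$ with $Tx_{\sigma(n)}\to\theta u$ for some $\theta\in\mathbb{T}$. *)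

(* Defs.v *)
From HB Require Import structures.
From mathcomp Require Import all_boot all_order all_algebra.
From mathcomp Require Import all_classical all_reals all_analysis.
From mathcomp Require Export complex.

Set Implicit Arguments.
Unset Strict Implicit.
Unset Printing Implicit Defensive.

Import Order.TTheory GRing.Theory Num.Theory.
Import numFieldNormedType.Exports.

Local Open Scope classical_set_scope.
Local Open Scope ring_scope.

(* Everything is stated over a numFieldType K so that it applies both to a
   realType R and to the complex numbers R[i].  In the latter case norms are
   elements of R[i] that are nonnegative, hence real; 0 < e and a <= b likewise
   only hold between numbers whose difference is real. *)

Definition unit_ball (K : numFieldType) (X : normedModType K) : set X :=
  [set x | `|x| <= 1].
Arguments unit_ball {K} X.

Definition bounded_operator (K : numFieldType) (X Y : normedModType K)
    (T : {linear X -> Y}) : Prop :=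
  exists M : K, forall x, `|T x| <= M * `|x|.

(* Least upper bound in K; over R[i] any upper bound of a nonempty set of real
   numbers is itself real, so this is the usual real supremum.  The value is
   only meaningful when T is bounded on the unit ball. *)
Definition opnorm (K : numFieldType) (X Y : normedModType K) (T : X -> Y) : K :=
  supremum 0 [set `|T x| | x in unit_ball X].

Definition dual (K : numFieldType) (Y : normedModType K) : Type :=
  {f : {linear Y -> K^o} | bounded_operator f}.

(* Y with its weak topology: the coarsest topology making every bounded linear
   functional continuous. *)
Definition weak_space (K : numFieldType) (Y : normedModType K) :
    topologicalType :=
  sup_topology (fun f : dual Y =>
    Topological.on (initial_topology (sval f : Y -> K^o))).

Definition compact_operator (K : numFieldType) (X Y : normedModType K)
    (T : {linear X -> Y}) : Prop :=
  bounded_operator T /\ precompact (T @` unit_ball X).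

Definition weakly_compact_operator (K : numFieldType) (X Y : normedModType K)
    (T : {linear X -> Y}) : Prop :=
  bounded_operator T /\
  precompact (T @` unit_ball X : set (weak_space Y)).

Definition uniquely_quasi_attains_norm (K : numFieldType)
    (X Y : normedModType K) (T : {linear X -> Y}) : Prop :=
  exists u : Y, forall x : nat -> X,
    (forall n, unit_ball X (x n)) ->
    `|T (x n)| @[n --> \oo] --> opnorm T ->
    exists2 sigma : nat -> nat, {homo sigma : m n / (m < n)%N} &
    exists2 theta : K, `|theta| = 1 &
      T (x (sigma n)) @[n --> \oo] --> theta *: u.

Definition opnorm_dense (K : numFieldType) (X Y : normedModType K)
    (A B : set {linear X -> Y}) : Prop :=
  A `<=` B /\
  forall T, B T -> forall e : K, 0 < e ->
    exists2 S, A S & opnorm (T \- S) < e.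

(* Main.v *)
(**
Let [D] be the image of the unit ball under [T].  Stegall's variational
principle gives an arbitrarily small functional [f] such that
[`|y| + Re (f y)] has a strong maximum on [D], at [l] say.  With [w] the unit
vector of suitable phase along [l], the operator [A y = y + f y *: w] satisfies
[`|A y| <= `|y| + `|f y|], with equality at [l].  As [D] is balanced, a sequence
maximizing [`|A (T x)|] on the unit ball is, up to unimodular factors, maximizing
for [`|y| + Re (f y)], so that [T x] converges to [l] up to these factors.  Hence
[A \o T], which is as (weakly) compact as [T], uniquely quasi attains its norm.

For the variational principle, let [h f] be the supremum of [phi + f] on [D].
If all slices [phi + f > h f - eta] had diameter greater than [d] for all [f] in
a ball, then by Hahn-Banach [h] would be uniformly far from differentiable
there, so that a small change of [f] keeps the subgradients of [h] away from
finitely many given points.  Iterating, choose [f n] converging to [f] and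
[y n] nearly maximizing [phi + f n], in such a way that the subgradients of [h]
at [f] stay away from a dense subset of the closed span of the [y n].  But a
weak cluster point of the [y n] is such a subgradient, and it belongs to this
closed span.
*)

Require Import Defs.
From HB Require Import structures.
From mathcomp Require Import all_boot all_order all_algebra.
From mathcomp Require Import all_classical all_reals all_analysis.
From mathcomp Require Import ring lra.

Set Implicit Arguments.
Unset Strict Implicit.
Unset Printing Implicit Defensive.

Import Order.TTheory GRing.Theory Num.Theory.
Import numFieldNormedType.Exports.

Local Open Scope classical_set_scope.
Local Open Scope ring_scope.
Local Open Scope complex_scope.

(** * The Hahn-Banach theorem *)

Section hahn_banach.
Context (R : realType) (V : lmodType R).
Implicit Types (p u : V -> R) (x y v : V).

Definition linear_functional u :=
  (forall x y, u (x + y) = u x + u y) /\ (forall a x, u (a *: x) = a * u x).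

Definition sublinear p :=
  (forall x y, p (x + y) <= p x + p y) /\
  (forall (t : R) x, 0 <= t -> p (t *: x) = t * p x).

Lemma sublinear0 p : sublinear p -> p 0 = 0.
Proof. by move=> [_ pZ]; rewrite -(scale0r 0) pZ ?mul0r. Qed.

Lemma sublinear_opp p x : sublinear p -> - p (- x) <= p x.
Proof.
move=> sp; have := sp.1 x (- x); rewrite subrr (sublinear0 sp) => ?; lra.
Qed.

(* [p' x] is the infimum of [p (x + t *: v) - t * p v] over [t >= 0]. *)
Lemma sublinear_slide p v : sublinear p ->
  exists p', [/\ sublinear p', forall x, p' x <= p x & p' (- v) <= - p v].
Proof.
move=> sp; have [pD pZ] := sp.
pose E x := [set p (x + t *: v) - t * p v | t in [set t | 0 <= t]].
have E0 x : E x !=set0 by exists (p (x + 0 *: v) - 0 * p v), 0 => /=.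
have Elb x : lbound (E x) (- p (- x)).
  move=> _ [t /= t0 <-]; have := pD (x + t *: v) (- x).
  by rewrite addrAC subrr add0r pZ// => ?; lra.
have infE x (t : R) : 0 <= t -> inf (E x) <= p (x + t *: v) - t * p v.
  by move=> t0; apply: ge_inf; [exists (- p (- x)); exact: Elb|exists t].
have ltE x (c : R) : (forall t, 0 <= t -> c <= p (x + t *: v) - t * p v) ->
    c <= inf (E x).
  by move=> h; apply: lb_le_inf => // _ [t /= t0 <-]; exact: h.
have scal (t : R) x : 0 < t -> t * inf (E x) <= inf (E (t *: x)).
  move=> t0; apply: (ltE) => s s0.
  have := infE x (t^-1 * s); rewrite mulr_ge0 ?invr_ge0 ?(ltW t0)// => /(_ isT).
  rewrite -(ler_pM2l t0) => /le_trans; apply.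
  rewrite mulrBr -(pZ t (x + _)) ?(ltW t0)// scalerDr scalerA !mulrA.
  by rewrite divff ?gt_eqF// !mul1r.
exists (fun x => inf (E x)); split.
- split=> [x y|t x t0].
    rewrite -lerBlDr; apply: (ltE) => t t0.
    suff: inf (E (x + y)) - (p (x + t *: v) - t * p v) <= inf (E y) by lra.
    apply: (ltE) => s s0.
    have := infE (x + y) (t + s); rewrite addr_ge0// => /(_ isT).
    have := pD (x + t *: v) (y + s *: v).
    by rewrite addrACA -scalerDl => ? ?; lra.
  have [->|t_neq0] := eqVneq t 0.
    rewrite scale0r mul0r; apply/eqP; rewrite eq_le; apply/andP; split.
      have := infE 0 0; rewrite lexx => /(_ isT).
      by rewrite scale0r addr0 (sublinear0 sp); lra.
    by have : - p (- 0) <= inf (E 0) by [exact: lb_le_inf]; rewrite oppr0 (sublinear0 sp) oppr0.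
  have {t_neq0}t0 : 0 < t by rewrite lt_neqAle eq_sym t_neq0.
  apply/eqP; rewrite eq_le scal// andbT.
  (* The reverse inequality is [scal] itself, for [t^-1] at the vector [t *: x]. *)
  have := scal t^-1 (t *: x); rewrite invr_gt0 => /(_ t0).
  by rewrite scalerA mulVf ?gt_eqF// scale1r ler_pdivrMl.
- by move=> x; have := infE x 0; rewrite lexx scale0r addr0 mul0r subr0; exact.
- have := infE (- v) 1; rewrite ler01 scale1r addNr mul1r (sublinear0 sp) sub0r.
  by apply.
Qed.

(** Oddness turns each inequality of sublinearity around, by evaluating it at the opposite
    vectors. *)
Lemma sublinear_odd_linear p : sublinear p ->
  (forall x, p (- x) <= - p x) -> linear_functional p.
Proof.
move=> sp h; have [pD pZ] := sp.
have pN x : p (- x) = - p x.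
  apply/eqP; rewrite eq_le h/=.
  by have := sublinear_opp x sp; lra.
split=> [x y|a x].
  apply/eqP; rewrite eq_le pD/=.
  by have := pD (- x) (- y); rewrite -opprD !pN; lra.
have [a0|a0] := leP 0 a; first exact: pZ.
by rewrite -[a]opprK scaleNr pN pZ ?oppr_ge0 ?(ltW a0)// [RHS]mulNr.
Qed.

(* By [sublinear_slide] a minimal sublinear functional is odd, hence linear. *)
Lemma hahn_banach p v : sublinear p ->
  exists u, [/\ linear_functional u, forall x, u x <= p x & u v = p v].
Proof.
(* Starting below [q] forces [u v = p v]: a linear [u <= q] satisfies
   [- u v <= q (- v) <= - p v]. *)
move=> sp; have [q [sq qp qv]] := sublinear_slide v sp.
pose T := {u : V -> R | sublinear u /\ forall x, u x <= q x}.
have t0 : T by exists q; split.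
(* The order is reversed, so that a maximal element for Zorn's lemma is a minimal functional. *)
pose rel_ge (a b : T) := `[< forall x, sval b x <= sval a x >].
have [||A Atot|u umax] := @ZL_preorder T t0 rel_ge.
- by move=> a; apply/asboolP.
- move=> a b c /asboolP ba /asboolP cb; apply/asboolP => x.
  exact: le_trans (cb x) (ba x).
- have [->|/set0P A0] := eqVneq A set0; first by exists t0.
  pose E x := [set sval a x | a in A].
  have E0 x : E x !=set0 by have [a Aa] := A0; exists (sval a x), a.
  have Elb x : lbound (E x) (- q (- x)).
    move=> _ [[a [sa aq]] Aa <-] /=; have := sublinear_opp x sa.
    by have := aq (- x); lra.
  have infE x a : A a -> inf (E x) <= sval a x.
    by move=> Aa; apply: ge_inf; [exists (- q (- x)); exact: Elb|exists a].
  have ltE x (c : R) : (forall a, A a -> c <= sval a x) -> c <= inf (E x).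
    by move=> h; apply: lb_le_inf => // _ [a Aa <-]; exact: h.
  have scal (t : R) x : 0 < t -> t * inf (E x) <= inf (E (t *: x)).
    move=> t0'; apply: (ltE) => a Aa; rewrite (proj1 (svalP a)).2 ?(ltW t0')//.
    by rewrite ler_pM2l// infE.
  have sinf : sublinear (fun x => inf (E x)).
    split=> [x y|t x t_ge0].
      suff: inf (E (x + y)) - inf (E y) <= inf (E x) by lra.
      apply: (ltE) => a Aa.
      suff: inf (E (x + y)) - sval a x <= inf (E y) by lra.
      apply: (ltE) => b Ab.
      (* The pointwise infimum of a chain is subadditive because the smaller of [a] and [b] can
         replace both. *)
      have key c : A c -> (forall z, sval c z <= sval a z) ->
          (forall z, sval c z <= sval b z) ->
          inf (E (x + y)) - sval a x <= sval b y.
        move=> Ac ca cb; have := infE (x + y) c Ac.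
        have := (proj1 (svalP c)).1 x y.
        by have := ca x; have := cb y; lra.
      by have [/asboolP ba|/asboolP ab] := Atot a b Aa Ab; [apply: (key b)|apply: (key a)].
    have [->|t_neq0] := eqVneq t 0.
      rewrite scale0r mul0r; apply/eqP; rewrite eq_le; apply/andP; split.
        have [a Aa] := A0; have := infE 0 a Aa.
        by rewrite (sublinear0 (proj1 (svalP a))).
      by apply: (ltE) => a Aa; rewrite (sublinear0 (proj1 (svalP a))).
    have {t_neq0}t_gt0 : 0 < t by rewrite lt_neqAle eq_sym t_neq0.
    apply/eqP; rewrite eq_le scal// andbT.
    have := scal t^-1 (t *: x); rewrite invr_gt0 => /(_ t_gt0).
    by rewrite scalerA mulVf ?gt_eqF// scale1r ler_pdivrMl.
  have infq x : inf (E x) <= q x.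
    have [a Aa] := A0; exact: le_trans (infE x a Aa) (proj2 (svalP a) x).
  pose w : T := exist _ (fun x => inf (E x)) (conj sinf infq).
  exists w => a Aa; apply/asboolP => x /=.
  exact: infE.
- case: u umax => u [su uq] umax.
  have lu : linear_functional u.
    apply: sublinear_odd_linear => // x.
    (* Minimality gives [u <= u'] as well, whence [u (- x) <= u' (- x) <= - u x]. *)
    have [u' [su' u'u u'x]] := sublinear_slide x su.
    have u'q y : u' y <= q y by exact: le_trans (u'u y) (uq y).
    pose w : T := exist _ u' (conj su' u'q).
    have /(umax w) : rel_ge (exist _ u (conj su uq)) w by exact/asboolP.
    move=> /asboolP/(_ (- x))/= /le_trans; exact.
  exists u; split=> // [x|]; first exact: le_trans (uq x) (qp x).
  apply/eqP; rewrite eq_le (le_trans (uq v) (qp v))/=.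
  have := uq (- v); rewrite -scaleN1r lu.2 mulN1r scaleN1r.
  by have := qv; lra.
Qed.

End hahn_banach.

(** * Nested balls of functionals *)

Section nested_balls.
Context (R : realType) (V : lmodType R) (N : V -> R).
Implicit Types (f g u : V -> R) (x y v : V) (r : R).

Definition seminorm_like := sublinear N /\ forall x, N (- x) = N x.

Definition within r f g := forall v, `|g v - f v| <= r * N v.

Hypothesis sN : seminorm_like.

Lemma seminorm_ge0 x : 0 <= N x.
Proof. by have := sublinear_opp x sN.1; rewrite sN.2; lra. Qed.

Lemma seminormB x y : N (x - y) = N (y - x).
Proof. by rewrite -sN.2 opprB. Qed.

Lemma seminorm_triangle z x y : N (x - y) <= N (x - z) + N (z - y).
Proof. by have := sN.1.1 (x - z) (z - y); rewrite addrA subrK. Qed.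

Lemma seminormZ a x : N (a *: x) = `|a| * N x.
Proof.
have [a0|a0] := leP 0 a; first by rewrite sN.1.2// ger0_norm.
by rewrite -sN.2 -scaleNr sN.1.2 ?oppr_ge0 ?(ltW a0)// ltr0_norm.
Qed.

Lemma within_refl r f : 0 <= r -> within r f f.
Proof. by move=> r0 v; rewrite subrr normr0 mulr_ge0// seminorm_ge0. Qed.

Lemma within_trans r r' r'' f g h : within r f g -> within r' g h ->
  r + r' <= r'' -> within r'' f h.
Proof.
move=> fg gh rr v; rewrite -(subrKA (g v)).
apply: le_trans (ler_normD _ _) _; apply: le_trans (lerD (gh v) (fg v)) _.
by rewrite -mulrDl addrC ler_wpM2r// seminorm_ge0.
Qed.

Lemma within_sym r f g : within r f g -> within r g f.
Proof. by move=> fg v; rewrite distrC. Qed.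

(** Halving keeps [r n * n.+1%:R] below [r 0], and the Archimedean property concludes. *)
Lemma halving_small (r : nat -> R) : (forall n, 0 < r n) ->
  (forall n, r n.+1 <= r n / 2) ->
  forall e, 0 < e -> exists n0, forall n, (n0 <= n)%N -> r n < e.
Proof.
move=> r0 rS e e0.
have rn n : r n * n.+1%:R <= r 0%N.
  elim: n => [|n IH]; first by rewrite mulr1.
  apply: le_trans IH; apply: le_trans (ler_wpM2r _ (rS n)) _ => //.
  rewrite -mulrA ler_wpM2l ?(ltW (r0 n))// -[n.+2]addn1 -[n.+1]addn1 !natrD.
  by have : 0 <= n%:R :> R by []; lra.
exists (Num.bound (r 0%N / e)) => n bn.
have : r 0%N / e < n.+1%:R.
  apply: lt_le_trans (archi_boundP _) _; first by rewrite divr_ge0 ?ltW.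
  by rewrite ler_nat ltnW.
rewrite ltr_pdivrMr// => h.
have := le_lt_trans (rn n) h; rewrite [_ * e]mulrC ltr_pM2r//.
Qed.

(** At each [v] the intervals of radius [r n * N v] around [F n v] meet pairwise, so the supremum of
    their left ends lies in all of them. Linearity passes to this limit since the radii tend to
    0. *)
Lemma nested_balls_limit (F : nat -> V -> R) (r : nat -> R) :
  (forall n, linear_functional (F n)) -> (forall n, 0 < r n) ->
  (forall n, r n.+1 <= r n / 2) ->
  (forall n, within (r n / 2) (F n) (F n.+1)) ->
  exists2 f, linear_functional f & forall n, within (r n) (F n) f.
Proof.
move=> lF r0 rS FS.
have Fm n k : within (r n) (F n) (F (n + k)%N).
  elim: k n => [|k IH] n; first by rewrite addn0; apply: within_refl; exact: ltW.
  rewrite addnS -addSn; apply: within_trans (FS n) (IH n.+1) _.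
  by have := rS n; lra.
have Fnm n m v : F n v - r n * N v <= F m v + r m * N v.
  have [nm|mn] := leqP n m.
    have := Fm n (m - n)%N v; rewrite subnKC// ler_norml => /andP[h _].
    by have := mulr_ge0 (ltW (r0 m)) (seminorm_ge0 v); lra.
  have := Fm m (n - m)%N v; rewrite subnKC ?(ltnW mn)// ler_norml => /andP[_ h].
  by have := mulr_ge0 (ltW (r0 n)) (seminorm_ge0 v); lra.
pose f v := sup [set F n v - r n * N v | n in [set: nat]].
have fle n v : f v <= F n v + r n * N v.
  apply: ge_sup; first by exists (F 0%N v - r 0%N * N v), 0%N.
  by move=> _ [m _ <-]; exact: Fnm.
have fge n v : F n v - r n * N v <= f v.
  apply: ub_le_sup; last by exists n.
  by exists (F 0%N v + r 0%N * N v) => _ [m _ <-]; exact: Fnm.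
have Ff n : within (r n) (F n) f.
  by move=> v; rewrite ler_norml; have := fle n v; have := fge n v; lra.
have small (a b : R) : (forall n, `|a| <= r n * b) -> a = 0.
  move=> h; apply/eqP; rewrite -normr_le0; apply/ler_addgt0Pl => e e0.
  rewrite addr0.
  have [n0 /(_ n0 (leqnn _)) rn] :=
    halving_small r0 rS (divr_gt0 e0 (ltr_wpDl (normr_ge0 b) ltr01)).
  apply: le_trans (h n0) _; apply: (@le_trans _ _ (r n0 * (`|b| + 1))).
    by rewrite ler_wpM2l ?(ltW (r0 _))// (le_trans (ler_norm b))// lerDl.
  by rewrite -ler_pdivlMr ?ltW// ltr_wpDl.
exists f => //; split=> [x y|a x]; apply/eqP; rewrite -subr_eq0; apply/eqP.
  apply: (small _ (N (x + y) + N x + N y)) => n.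
  have := Ff n (x + y); have := Ff n x; have := Ff n y.
  rewrite (lF n).1 !ler_norml !mulrDr => /andP[? ?] /andP[? ?] /andP[? ?].
  by apply/andP; split; lra.
apply: (small _ (N (a *: x) + `|a| * N x)) => n.
have -> : f (a *: x) - a * f x =
    (f (a *: x) - F n (a *: x)) - a * (f x - F n x).
  by rewrite (lF n).2; ring.
apply: le_trans (ler_normB _ _) _; rewrite [leRHS]mulrDr lerD ?Ff// normrM mulrCA.
by rewrite ler_wpM2l// Ff.
Qed.

(* A player of the Banach-Mazur game on functionals, with memory [s n], wins
   if each [P n (s n)] can be forced on a ball. *)
Lemma banach_mazur (S : Type) (s0 : S) (upd : nat -> S -> (V -> R) -> S)
    (P : nat -> S -> (V -> R) -> Prop) f0 r0 :
  linear_functional f0 -> 0 < r0 ->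
  (forall n s f r, linear_functional f -> 0 < r ->
    (forall g, within r f g -> within r0 f0 g) ->
    exists f' r', [/\ linear_functional f', 0 < r' <= r / 2, within (r / 2) f f'
      & forall g, linear_functional g -> within r' f' g -> P n s g]) ->
  exists (F : nat -> V -> R) (r : nat -> R) (s : nat -> S) f,
    [/\ s 0%N = s0 /\ forall n, s n.+1 = upd n (s n) (F n),
        linear_functional f /\ within r0 f0 f,
        forall n, linear_functional (F n) /\ within r0 f0 (F n),
        (forall n, 0 < r n /\ within (r n) (F n) f) /\
        (forall e, 0 < e -> exists n0, forall n, (n0 <= n)%N -> r n < e)
      & forall n, P n (s n) f].
Proof.
move=> lf0 r0_gt0 H.
pose X := (nat * S * (V -> R) * R)%type.
pose good f r := [/\ linear_functional f, 0 < r &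
  forall g, within r f g -> within r0 f0 g].
have /choice[step stepP] : forall x : X, exists y : (V -> R) * R,
    let: (n, s, f, r) := x in good f r ->
    [/\ linear_functional y.1, 0 < y.2 <= r / 2, within (r / 2) f y.1
      & forall g, linear_functional g -> within y.2 y.1 g -> P n s g].
  move=> [[[n s] f] r].
  (* The default move [(f, r)] is never played: all positions reached are [good], by [goodn]
     below. *)
  have [[lf r_gt0 fr]|nG] := pselect (good f r); last by exists (f, r).
  have [f' [r' [? ? ? ?]]] := H n s f r lf r_gt0 fr.
  by exists (f', r').
pose fix st n : S * (V -> R) * R := if n is m.+1 then
    let: (s, f, r) := st m in let y := step (m, s, f, r) in
    (upd m s f, y.1, y.2)
  else (s0, f0, r0).
pose s n := (st n).1.1; pose F n := (st n).1.2; pose r n := (st n).2.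
have stE n : [/\ s n.+1 = upd n (s n) (F n),
    F n.+1 = (step (n, s n, F n, r n)).1 &
    r n.+1 = (step (n, s n, F n, r n)).2].
  by rewrite /s /F /r /=; case: (st n) => [[? ?] ?].
have goodn n : good (F n) (r n).
  elim: n => [|n IH]; first by split.
  have [_ FE rE] := stE n.
  have [l1 /andP[r1 r2] w1 _] := stepP (n, s n, F n, r n) IH.
  have [_ _ sub] := IH; rewrite -FE -rE in l1 r1 r2 w1.
  split=> // g wg; apply: sub; apply: within_trans w1 wg _; lra.
have stepn n := stepP (n, s n, F n, r n) (goodn n).
have rpos n : 0 < r n by have [] := goodn n.
have rS n : r n.+1 <= r n / 2.
  by have [_ _ ->] := stE n; have [_ /andP[]] := stepn n.
have FS n : within (r n / 2) (F n) (F n.+1).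
  by have [_ -> _] := stE n; have [] := stepn n.
have lF n : linear_functional (F n) by have [] := goodn n.
have [f lf Ff] := nested_balls_limit lF rpos rS FS.
exists F, r, s, f; split=> //.
- by split=> // n; have [] := stE n.
- by split=> //; exact: Ff 0%N.
- move=> n; split=> //; have [_ _ ] := goodn n; apply.
  by apply: within_refl; exact: ltW.
- by split=> //; exact: halving_small.
- move=> n; have [_ _ _] := stepn n; apply=> //.
  by have [_ <- <-] := stE n; exact: Ff.
Qed.

End nested_balls.

(** * Separation from a closed span *)

Section closed_span.
Context (R : realType) (V : lmodType R) (N : V -> R).
Hypothesis sN : seminorm_like N.

(** Hahn-Banach is applied to the distance to [W], a sublinear functional below [N]. It vanishes on
    the subspace [W], which forces [u] to be both nonpositive and nonnegative there. *)
Lemma distance_functional (W : set V) p c : W 0 ->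
  (forall x y, W x -> W y -> W (x + y)) -> (forall a x, W x -> W (a *: x)) ->
  (forall w, W w -> c <= N (p - w)) ->
  exists u, [/\ linear_functional u, forall x, `|u x| <= N x,
    forall w, W w -> u w = 0 & c <= u p].
Proof.
move=> W0 WD WZ Wp.
pose E x := [set N (x - w) | w in W].
have E0 x : E x !=set0 by exists (N (x - 0)), 0.
have infE x w : W w -> inf (E x) <= N (x - w).
  move=> Ww; apply: ge_inf; last by exists w.
  by exists 0 => _ [w' _ <-]; exact: seminorm_ge0.
have ltE x (b : R) : (forall w, W w -> b <= N (x - w)) -> b <= inf (E x).
  by move=> h; apply: lb_le_inf => // _ [w Ww <-]; exact: h.
have scal (t : R) x : 0 < t -> t * inf (E x) <= inf (E (t *: x)).
  move=> t0; apply: (ltE) => w Ww.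
  have := infE x (t^-1 *: w) (WZ _ _ Ww); rewrite -(ler_pM2l t0) => /le_trans.
  apply; rewrite -sN.1.2 ?(ltW t0)// scalerBr scalerA divff ?gt_eqF//.
  by rewrite scale1r.
have q0 x : W x -> inf (E x) = 0.
  move=> Wx; apply/eqP; rewrite eq_le; apply/andP; split.
    by have := infE x x Wx; rewrite subrr (sublinear0 sN.1).
  by apply: (ltE) => w _; exact: seminorm_ge0.
have sq : sublinear (fun x => inf (E x)).
  split=> [x y|t x t_ge0].
    rewrite -lerBlDr; apply: (ltE) => w Ww.
    suff: inf (E (x + y)) - N (x - w) <= inf (E y) by lra.
    apply: (ltE) => w' Ww'; have := infE (x + y) _ (WD _ _ Ww Ww').
    by rewrite opprD addrACA; have := sN.1.1 (x - w) (y - w'); lra.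
  have [->|t_neq0] := eqVneq t 0; first by rewrite scale0r mul0r q0.
  have {t_neq0}t_gt0 : 0 < t by rewrite lt_neqAle eq_sym t_neq0.
  apply/eqP; rewrite eq_le scal// andbT.
  have := scal t^-1 (t *: x); rewrite invr_gt0 => /(_ t_gt0).
  by rewrite scalerA mulVf ?gt_eqF// scale1r ler_pdivrMl.
have [u [lu uq up]] := hahn_banach p sq.
have uN x : u (- x) = - u x by rewrite -scaleN1r lu.2 mulN1r.
have uleN x : u x <= N x.
  by apply: le_trans (uq x) _; have := infE x 0 W0; rewrite subr0.
exists u; split=> //.
- by move=> x; rewrite ler_norml uleN andbT lerNl -uN -[N x]sN.2 uleN.
- move=> w Ww; apply/eqP; rewrite eq_le.
  have := uq w; rewrite q0// => ->/=.
  have := uq (- w); rewrite uN -scaleN1r q0; last exact: WZ.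
  by rewrite oppr_le0.
- by rewrite up; exact: ltE.
Qed.

Lemma norming_functional p :
  exists u, [/\ linear_functional u, forall x, `|u x| <= N x & u p = N p].
Proof.
have [u [lu uN _ up]] : exists u, [/\ linear_functional u,
    forall x, `|u x| <= N x, forall w, [set 0] w -> u w = 0 & N p <= u p].
  apply: distance_functional => // [x y -> ->|a x ->|w ->].
  - by rewrite addr0.
  - by rewrite scaler0.
  - by rewrite subr0.
exists u; split=> //; apply/eqP; rewrite eq_le up andbT.
exact: le_trans (ler_norm _) (uN p).
Qed.

(** An enumeration of the rationals, with 0 at the codes that represent none. *)
Definition dense_scalar (k : nat) : R :=
  if unpickle k is Some q then ratr q else 0.

Lemma dense_scalarP (t e : R) : 0 < e -> exists k, `|t - dense_scalar k| < e.
Proof.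
move=> e0; have /rat_in_itvoo[q] : t - e < t + e by lra.
rewrite in_itv/= => /andP[tq qt]; exists (pickle q).
by rewrite /dense_scalar pickleK ltr_norml; apply/andP; split; lra.
Qed.

(* Iterated, this yields a set closed under sums and rational multiples. *)
Definition enlarge (n : nat) (s : seq V) (y : V) : seq V :=
  y :: s ++ [seq a + b | a <- s, b <- s] ++
    [seq dense_scalar k *: a | k <- iota 0 n.+1, a <- s].

Lemma mem_enlargeD n s y a b :
  a \in s -> b \in s -> a + b \in enlarge n s y.
Proof.
by move=> sa sb; rewrite inE !mem_cat (allpairs_f _ sa sb) !orbT.
Qed.

Lemma mem_enlargeZ n s y k a :
  (k <= n)%N -> a \in s -> dense_scalar k *: a \in enlarge n s y.
Proof.
move=> kn sa; have kI : k \in iota 0 n.+1 by rewrite mem_iota.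
rewrite /enlarge; move: (iota 0 n.+1) kI => ks kI.
by rewrite inE !mem_cat [X in [|| _, _, _ | X]]allpairs_f ?orbT.
Qed.

(** The closure [W] of the union of the lists [zs n] is a real subspace containing all [y n], and
    [p] stays at distance at least [c / 2] from it, so that [distance_functional] applies. *)
Lemma enlarge_closed_span (y : nat -> V) (zs : nat -> seq V) p c : 0 < c ->
  (forall n, zs n.+1 = enlarge n (zs n) (y n)) ->
  (forall n z, z \in zs n -> c <= N (p - z)) ->
  exists u, [/\ linear_functional u, forall x, `|u x| <= N x,
    forall n, u (y n) = 0 & 0 < u p].
Proof.
move=> c0 zsS zsp.
have zs_mono n m : (n <= m)%N -> {subset zs n <= zs m}.
  move=> /subnK <-; elim: (m - n)%N => [//|k IH] z /IH.
  by rewrite addSn zsS inE !mem_cat => ->; rewrite orbT.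
pose W := [set v | forall e : R, 0 < e -> exists n z, z \in zs n /\ N (v - z) < e].
have Wy n : W (y n).
  move=> e e0; exists n.+1, (y n); rewrite zsS inE eqxx; split=> //.
  by rewrite subrr (sublinear0 sN.1).
have WZ a x : W x -> W (a *: x).
  move=> Wx e e0.
  have e0' : 0 < e / 2 / (`|a| + 1) by rewrite !divr_gt0// ltr_wpDl.
  have [n [z [zn xz]]] := Wx _ e0'.
  have Nz := seminorm_ge0 sN z.
  have e0'' : 0 < e / 2 / (N z + 1) by rewrite !divr_gt0// ltr_wpDl.
  have [k ak] := dense_scalarP a e0''.
  (* Stage [m] multiplies only by the scalars of index at most [m], hence the maximum with [k]. *)
  exists (maxn n k).+1, (dense_scalar k *: z); split.
    rewrite zsS; apply: mem_enlargeZ; first exact: leq_maxr.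
    by apply: zs_mono zn; exact: leq_maxl.
  apply: le_lt_trans (seminorm_triangle sN (a *: z) _ _) _.
  rewrite -scalerBr -scalerBl !(seminormZ sN).
  have h1 : `|a| * N (x - z) <= e / 2.
    apply: le_trans (_ : (`|a| + 1) * N (x - z) <= _).
      by rewrite ler_wpM2r ?(seminorm_ge0 sN)// lerDl.
    by move: xz; rewrite ltr_pdivlMr ?ltr_wpDl// mulrC => /ltW.
  have h2 : `|a - dense_scalar k| * N z < e / 2.
    apply: le_lt_trans (_ : `|a - dense_scalar k| * (N z + 1) < _).
      by rewrite ler_wpM2l// lerDl.
    by move: ak; rewrite ltr_pdivlMr ?ltr_wpDl.
  by lra.
have WD x x' : W x -> W x' -> W (x + x').
  move=> Wx Wx' e e0.
  have [n [z [zn xz]]] := Wx _ (divr_gt0 e0 (ltr0Sn _ 1)).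
  have [m [z' [zm xz']]] := Wx' _ (divr_gt0 e0 (ltr0Sn _ 1)).
  exists (maxn n m).+1, (z + z'); split.
    rewrite zsS; apply: mem_enlargeD.
      by apply: zs_mono zn; exact: leq_maxl.
    by apply: zs_mono zm; exact: leq_maxr.
  rewrite opprD addrACA; apply: le_lt_trans (sN.1.1 _ _) _; lra.
have [|w Ww|u [lu uN uW up]] := @distance_functional W p (c / 2) _ WD WZ.
- by rewrite -(scale0r (y 0%N)); exact: WZ.
- have [n [z [zn wz]]] := Ww _ (divr_gt0 c0 (ltr0Sn _ 1)).
  have := zsp _ _ zn; have := seminorm_triangle sN w p z; lra.
- exists u; split=> // [n|]; first exact: uW.
  by apply: lt_le_trans up; rewrite divr_gt0.
Qed.

End closed_span.

(** * Stegall's variational principle *)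

Section stegall.
Context (R : realType) (V : lmodType R) (N : V -> R).
Context (D : set V) (M : R) (phi : V -> R).
Hypothesis sN : seminorm_like N.
Hypothesis D0 : D !=set0.
Hypothesis DM : forall y, D y -> N y <= M.
Hypothesis phiM : forall y, D y -> phi y <= M.

Definition bounded_functional (f : V -> R) :=
  linear_functional f /\ exists c, forall x, `|f x| <= c * N x.

(* The only form of weak compactness that the argument needs. *)
Definition weak_cluster_property := forall y : nat -> V, (forall n, D (y n)) ->
  exists p, forall g b, bounded_functional g ->
    (exists n0, forall n, (n0 <= n)%N -> g (y n) <= b) -> g p <= b.

Definition support (f : V -> R) : R := sup [set phi y + f y | y in D].

Definition slice (f : V -> R) (eta : R) : set V :=
  [set y | D y /\ support f - eta < phi y + f y].

Definition small_slice (d : R) (f : V -> R) := exists2 eta, 0 < eta &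
  forall y y', slice f eta y -> slice f eta y' -> N (y - y') <= d.

(** The subgradients at [f] of the convex function [support] that are represented by points of [V];
    these points need not belong to [D]. *)
Definition subgradient (f : V -> R) (p : V) := forall g, bounded_functional g ->
  g p <= support (fun v => f v + g v) - support f.

Lemma bounded_functionalD f g : bounded_functional f -> bounded_functional g ->
  bounded_functional (fun v => f v + g v).
Proof.
move=> [lf [c fc]] [lg [d gd]]; split.
  split=> [x y|a x]; first by rewrite lf.1 lg.1 addrACA.
  by rewrite lf.2 lg.2 mulrDr.
exists (c + d) => x; rewrite mulrDl; apply: le_trans (ler_normD _ _) _.
exact: lerD.
Qed.

Lemma bounded_functionalN f : bounded_functional f ->
  bounded_functional (fun v => - f v).
Proof.
move=> [lf [c fc]]; split; last by exists c => x; rewrite normrN.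
by split=> [x y|a x]; [rewrite lf.1 opprD|rewrite lf.2 mulrN].
Qed.

Lemma bounded_functional_within r f g : bounded_functional f ->
  linear_functional g -> within N r f g -> bounded_functional g.
Proof.
move=> [lf [c fc]] lg fg; split=> //; exists (c + r) => x.
rewrite -[g x](addrNK (f x)) addrC mulrDl; apply: le_trans (ler_normD _ _) _.
exact: lerD.
Qed.

Lemma bound_ge0 : 0 <= M.
Proof. by have [y /DM] := D0; apply: le_trans; exact: seminorm_ge0. Qed.

Lemma within_on r f g y : 0 <= r -> within N r f g -> D y ->
  `|g y - f y| <= r * M.
Proof.
by move=> r0 fg Dy; apply: le_trans (fg y) _; rewrite ler_wpM2l// DM.
Qed.

Lemma support_ge f y : bounded_functional f -> D y -> phi y + f y <= support f.
Proof.
move=> [_ [c fc]] Dy; apply: ub_le_sup; last by exists y.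
exists (M + `|c| * M) => _ [z Dz <-]; apply: lerD; first exact: phiM.
apply: le_trans (ler_norm _) _; apply: le_trans (fc z) _.
have := DM Dz; have := seminorm_ge0 sN z => Nz NM.
apply: (@le_trans _ _ (`|c| * N z)); first by rewrite ler_wpM2r// ler_norm.
by rewrite ler_wpM2l.
Qed.

Lemma support_le f b : (forall y, D y -> phi y + f y <= b) -> support f <= b.
Proof.
move=> fb; apply: ge_sup; last by move=> _ [y Dy <-]; exact: fb.
by have [y Dy] := D0; exists (phi y + f y), y.
Qed.

Lemma slice_nonempty f eta : bounded_functional f -> 0 < eta ->
  exists y, slice f eta y.
Proof.
move=> bf eta0; have [|_ [y Dy <-] h] := @sup_adherent R [set phi y + f y | y in D] eta eta0.
  split; first by have [y Dy] := D0; exists (phi y + f y), y.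
  by exists (support f) => _ [y Dy <-]; exact: support_ge.
by exists y.
Qed.

Lemma support_within r f g : 0 <= r -> bounded_functional f ->
  within N r f g -> support g <= support f + r * M.
Proof.
move=> r0 bf fg; apply: support_le => y Dy.
have := within_on r0 fg Dy; rewrite ler_norml => /andP[_ h].
by have := support_ge bf Dy; lra.
Qed.

(** Two points [y], [y'] of a thin slice are more than [d] apart. With [g] equal to [r] times a
    functional norming [y - y'], testing [f + g] at [y] and [f - g] at [y'] gains [r * d] and loses
    twice the thickness [r * d / 4]. *)
Lemma support_gap f r d : bounded_functional f -> ~ small_slice d f ->
  0 < r -> 0 < d ->
  exists g, [/\ bounded_functional g, forall v, `|g v| <= r * N v &
    2 * support f + r * d / 2 <=
    support (fun v => f v + g v) + support (fun v => f v - g v)].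
Proof.
move=> bf big r0 d0; have eta0 : 0 < r * d / 4 by rewrite divr_gt0// mulr_gt0.
have [y [y' [[Dy hy] [Dy' hy'] yy']]] : exists y y',
    [/\ slice f (r * d / 4) y, slice f (r * d / 4) y' & d < N (y - y')].
  apply: contrapT => h; apply: big; exists (r * d / 4) => // y y' sy sy'.
  by rewrite leNgt; apply/negP => yy'; apply: h; exists y, y'.
have [u [lu uN uyy']] := norming_functional sN (y - y').
pose g v := r * u v.
have gr v : `|g v| <= r * N v by rewrite normrM gtr0_norm// ler_wpM2l// ltW.
have bg : bounded_functional g.
  split; last by exists r.
  by split=> [a b|a b]; rewrite /g ?lu.1 ?lu.2; ring.
exists g; split=> //.
have h1 := support_ge (bounded_functionalD bf bg) Dy.
have h2 := support_ge (bounded_functionalD bf (bounded_functionalN bg)) Dy'.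
have : g y - g y' = r * N (y - y').
  by rewrite -uyy' /g lu.1 -scaleN1r lu.2; ring.
have : r * d <= r * N (y - y') by rewrite ler_pM2l// ltW.
rewrite /= in h1 h2; lra.
Qed.

(** Moving from [f] to [f + g] raises [support] by more than [g z]. A subgradient [p] near [f + g],
    tested in the direction [- g] leading back to [f], must then have [g p] well above [g z]; as [g]
    has norm at most [r / 2], [p] is far from [z]. *)
Lemma avoid_point f r d z : bounded_functional f -> ~ small_slice d f ->
  0 < r -> 0 < d ->
  exists f' r', [/\ linear_functional f', 0 < r' <= r / 2, within N (r / 2) f f'
    & forall f'', linear_functional f'' -> within N r' f' f'' ->
      forall p, subgradient f'' p -> d / 8 <= N (p - z)].
Proof.
move=> bf big r0 d0; have r20 : 0 < r / 2 by rewrite divr_gt0.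
have M0 := bound_ge0.
have [g [bg gr gap]] : exists g, [/\ bounded_functional g,
    forall v, `|g v| <= r / 2 * N v &
    support f + g z + r * d / 8 <= support (fun v => f v + g v)].
  have [g [bg gr gap]] := support_gap bf big r20 d0.
  (* For radius [r / 2] the gap is [r * d / 4], so one of [g] and [- g] gets at least half of it. *)
  have [h|h] := leP (support f + g z + r * d / 8) (support (fun v => f v + g v)).
    by exists g.
  exists (fun v => - g v); split; first exact: bounded_functionalN.
    by move=> v; rewrite normrN.
  by rewrite /=; lra.
pose f' v := f v + g v.
have bf' : bounded_functional f' by exact: bounded_functionalD.
(* Two errors of size [r' * M] then use up at most half of the gain [r * d / 8]. *)
pose r' := Num.min (r / 2) (r * d / (32 * (M + 1))).
have M1 : 0 < 32 * (M + 1) by rewrite mulr_gt0// ltr_wpDl.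
have r'0 : 0 < r' by rewrite lt_min r20/= divr_gt0// mulr_gt0.
have r'M : 2 * (r' * M) <= r * d / 16.
  have : r' * (32 * (M + 1)) <= r * d by rewrite -ler_pdivlMr// ge_min lexx orbT.
  by lra.
exists f', r'; split=> //; first exact: bf'.1.
- by rewrite r'0 ge_min lexx.
- by move=> v; rewrite /f' addrAC subrr add0r.
move=> f'' lf'' f'f'' p pf.
have bf'' := bounded_functional_within bf' lf'' f'f''.
have := pf _ (bounded_functionalN bg).
have h1 := support_within (ltW r'0) bf'' (within_sym f'f'').
have h2 : support (fun v => f'' v - g v) <= support f + r' * M.
  apply: support_within => //; first exact: ltW.
  by move=> v; have := f'f'' v; rewrite /f'; congr (`|_| <= _); ring.
move=> h3; have : r * d / 16 <= g (p - z).
  by rewrite bg.1.1 -scaleN1r bg.1.2 mulN1r; rewrite /f' in h1; lra.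
move=> /le_trans/(_ (le_trans (ler_norm _) (gr _))).
by move=> h; rewrite -(ler_pM2l r20); lra.
Qed.

(** The points are avoided one after the other in nested balls. Shrinking a ball keeps what has been
    achieved, and each new centre stays in the ball around [f0] where no slice is small. *)
Lemma avoid_points f0 r0 d (zs : seq V) f (r : R) :
  bounded_functional f0 -> 0 < d ->
  (forall f, linear_functional f -> within N r0 f0 f -> ~ small_slice d f) ->
  linear_functional f -> 0 < r ->
  (forall g, within N r f g -> within N r0 f0 g) ->
  exists f' r', [/\ linear_functional f', 0 < r' <= r / 2, within N (r / 2) f f'
    & forall f'', linear_functional f'' -> within N r' f' f'' ->
      forall p, subgradient f'' p -> forall z, z \in zs -> d / 8 <= N (p - z)].
Proof.
move=> bf0 d0 big; elim: zs f r => [|z zs IH] f r lf r_gt0 fr.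
  exists f, (r / 2); split=> //; first by rewrite divr_gt0/=.
  by apply: within_refl => //; rewrite divr_ge0// ltW.
have f0f : within N r0 f0 f.
  by apply: fr; apply: within_refl => //; exact: ltW.
have bf := bounded_functional_within bf0 lf f0f.
have r20 : 0 < r / 2 by rewrite divr_gt0.
have [f1 [r1 [lf1 /andP[r1_gt0 r1r] ff1 h1]]] :=
  avoid_point z bf (big f lf f0f) r20 d0.
have [g f1g|f2 [r2 [lf2 /andP[r2_gt0 r2r] f12 h2]]] := IH f1 r1 lf1 r1_gt0.
  by apply: fr; apply: (within_trans sN ff1 f1g); lra.
exists f2, r2; split=> //.
- by rewrite r2_gt0/=; lra.
- by apply: (within_trans sN ff1 f12); lra.
move=> f'' lf'' f2f'' p pf z'; rewrite inE => /predU1P[->|z'zs].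
  by apply: (h1 f'') => //; apply: (within_trans sN f12 f2f''); lra.
exact: (h2 f'').
Qed.

Lemma small_slice_dense f0 r0 d : weak_cluster_property ->
  bounded_functional f0 -> 0 < r0 -> 0 < d ->
  exists f, [/\ linear_functional f, within N r0 f0 f & small_slice d f].
Proof.
move=> Dweak bf0 r0_gt0 d0; apply: contrapT => none.
have big f : linear_functional f -> within N r0 f0 f -> ~ small_slice d f.
  by move=> lf f0f sf; apply: none; exists f.
have /choice[pt ptP] : forall x : nat * (V -> R), exists y,
    bounded_functional x.2 -> slice x.2 (1 / x.1.+1%:R) y.
  move=> [n f]; have [bf|nb] := pselect (bounded_functional f); last by exists 0.
  have [|y] := @slice_nonempty f (1 / n.+1%:R) bf; first by rewrite divr_gt0.
  by exists y.
(* The memory of the game is the list [zs] of points to avoid, to which every turn adds the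
   near-maximizer [pt (n, f)] of the current functional, with sums and rational multiples of the
   earlier points. *)
pose P (n : nat) (zs : seq V) f := forall p, subgradient f p ->
  forall z, z \in zs -> d / 8 <= N (p - z).
have [n zs f r lf r_gt0 fr|] :=
  @banach_mazur R V N sN _ [::] (fun n zs f => enlarge n zs (pt (n, f))) P
    f0 r0 bf0.1 r0_gt0.
  exact: (avoid_points zs bf0 d0 big lf r_gt0 fr).
move=> F [r [zs [f [[zs0 zsS] [lf f0f] FP [rP r_small] fP]]]].
have bF n : bounded_functional (F n).
  by have [lF] := FP n; exact: bounded_functional_within.
have bf := bounded_functional_within bf0 lf f0f.
pose y n := pt (n, F n).
have yP n : slice (F n) (1 / n.+1%:R) (y n) by exact: (ptP (n, F n) (bF n)).
have [p pP] := Dweak y (fun n => (yP n).1).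
have M0 := bound_ge0.
(* As [y n] nearly maximizes [phi + F n], it nearly maximizes [phi + f], so [g (y n)] is eventually
   at most [support (f + g) - support f + e]. The error [e] consists of [e / 2] for the slice and
   two times [e / 4] for replacing [F n] by [f]. *)
have sub_p : subgradient f p.
  move=> g bg; apply/ler_addgt0Pl => e e0; apply: pP => //.
  have e0' : 0 < e / 4 / (M + 1) by rewrite !divr_gt0// ltr_wpDl.
  have [n0 rn0] := r_small _ e0'.
  exists (maxn n0 (Num.bound (2 / e))) => n; rewrite geq_max => /andP[n0n en].
  have [q qe hq] : exists2 q, q <= e / 2 &
      support (F n) - q < phi (y n) + F n (y n).
    exists (1 / n.+1%:R); last by have [] := yP n.
    rewrite ler_pdivrMr// -ler_pdivrMl ?divr_gt0// mulr1 invf_div.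
    apply: ltW; apply: lt_le_trans (archi_boundP _) _.
      by rewrite divr_ge0// ltW.
    by rewrite ler_nat ltnW.
  have [rn_gt0 Fnf] := rP n.
  have rnM : r n * M <= e / 4.
    by have := rn0 n n0n; rewrite ltr_pdivlMr ?ltr_wpDl//; lra.
  have := within_on (ltW rn_gt0) Fnf (yP n).1; rewrite ler_norml => /andP[h1 _].
  have := support_within (ltW rn_gt0) (bF n) Fnf.
  have /= := support_ge (bounded_functionalD bf bg) (yP n).1.
  by lra.
(* A functional vanishing at all [y n] is nonpositive at their weak cluster point [p], whereas [u p]
   is positive. *)
have [u [lu uN uy up]] := enlarge_closed_span sN (divr_gt0 d0 (ltr0Sn _ 7)) zsS
  (fun n z zn => fP n p sub_p z zn).
have : u p <= 0.
  apply: pP; last by exists 0%N => n _; rewrite uy.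
  by split=> //; exists 1 => x; rewrite mul1r.
by lra.
Qed.

(** Moving [f] by [r] changes both [phi + f] on [D] and [support] by at most [r * M], so that a
    slice of half the thickness for [g] lies inside the slice for [f]. *)
Lemma small_slice_within f d : bounded_functional f -> small_slice d f ->
  exists2 r, 0 < r &
    forall g, linear_functional g -> within N r f g -> small_slice d g.
Proof.
move=> bf [eta eta0 feta]; have M0 := bound_ge0.
have M1 : 0 < 4 * (M + 1) by rewrite mulr_gt0// ltr_wpDl.
exists (eta / (4 * (M + 1))); first by rewrite divr_gt0.
set r := eta / _ => g lg fg.
have r_gt0 : 0 < r by rewrite divr_gt0.
have rM : 2 * (r * M) <= eta / 2.
  by have : r * (4 * (M + 1)) = eta by [rewrite mulfVK// gt_eqF]; lra.
have bg := bounded_functional_within bf lg fg.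
exists (eta / 2); first by rewrite divr_gt0.
suff sub y : slice g (eta / 2) y -> slice f eta y.
  by move=> y y' /sub sy /sub sy'; exact: feta.
move=> [Dy hy]; split=> //.
have := within_on (ltW r_gt0) fg Dy; rewrite ler_norml => /andP[_ h1].
by have := support_within (ltW r_gt0) bg (within_sym fg); lra.
Qed.

(** A Baire category argument: for each [d] the functionals with a slice of diameter at most [d] are
    dense and open. The game needs no memory here. *)
Lemma stegall e : weak_cluster_property -> 0 < e ->
  exists f, [/\ linear_functional f, forall v, `|f v| <= e * N v &
    forall d, 0 < d -> small_slice d f].
Proof.
move=> Dweak e0; pose f0 (v : V) : R := 0.
have bf0 : bounded_functional f0.
  split; first by split=> *; rewrite /f0 ?addr0 ?mulr0.
  by exists 0 => x; rewrite normr0 mul0r.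
pose P (n : nat) (s : unit) f := small_slice (1 / n.+1%:R) f.
have [n [] f r lf r_gt0 fr|] :=
  @banach_mazur R V N sN _ tt (fun _ _ _ => tt) P f0 e bf0.1 e0.
  have bf : bounded_functional f.
    apply: (bounded_functional_within bf0 lf); apply: fr.
    by apply: within_refl => //; exact: ltW.
  have [||f' [lf' ff' sf']] := @small_slice_dense f (r / 2) (1 / n.+1%:R) Dweak bf;
    [by rewrite divr_gt0..|].
  have [r' r'0 h] := small_slice_within (bounded_functional_within bf lf' ff') sf'.
  exists f', (Num.min r' (r / 2)); split=> //.
    by rewrite lt_min r'0 divr_gt0//= ge_min lexx orbT.
  move=> g lg f'g; apply: h => // v; apply: le_trans (f'g v) _.
  by rewrite ler_wpM2r ?(seminorm_ge0 sN)// ge_min lexx.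
move=> _ [_ [s [f [_ [lf f0f] _ _ fP]]]]; exists f; split=> //.
  by move=> v; have := f0f v; rewrite subr0.
move=> d d0; have [eta eta0 h] := fP (Num.bound d^-1).
exists eta => // y y' sy sy'; apply: le_trans (h _ _ sy sy') _.
rewrite ler_pdivrMr// -ler_pdivrMl// mulr1.
apply: ltW; apply: lt_le_trans (archi_boundP _) _; first by rewrite invr_ge0 ltW.
by rewrite ler_nat leqnSn.
Qed.

End stegall.

(** * Real and complex scalars *)

(** An alias carrying [inj], so that the action of [R] is found from the type and does not clash
    with that of [K] on [Y]. *)
Definition restrict_scalars (R K : pzRingType) (inj : {rmorphism R -> K})
  (Y : lmodType K) : Type := Y.

Section restrict_scalars.
Context (R K : pzRingType) (inj : {rmorphism R -> K}) (Y : lmodType K).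
Local Notation V := (restrict_scalars inj Y).

HB.instance Definition _ := GRing.Zmodule.on V.

Let scale (r : R) (v : V) : V := inj r *: (v : Y).

Let scaleA a b v : scale a (scale b v) = scale (a * b) v.
Proof. by rewrite /scale scalerA rmorphM. Qed.

Let scale1 : left_id 1 scale.
Proof. by move=> v; rewrite /scale rmorph1 scale1r. Qed.

Let scaleDr : right_distributive scale +%R.
Proof. by move=> a x y; rewrite /scale scalerDr. Qed.

Let scaleDl v : {morph scale^~ v : a b / a + b}.
Proof. by move=> a b; rewrite /scale rmorphD scalerDl. Qed.

HB.instance Definition _ :=
  GRing.Zmodule_isLmodule.Build R V scaleA scale1 scaleDr scaleDl.

End restrict_scalars.

(* What is used of the scalar field [K], uniformly for [R] and [R[i]]: [inj] is
   the inclusion of the reals and [re] the real part. *)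
Record real_or_complex (R : realType) (K : numFieldType)
    (inj : {rmorphism R -> K}) (re : K -> R) : Prop := RealOrComplex {
  re_add : forall a b, re (a + b) = re a + re b;
  re_inj : forall r, re (inj r) = r;
  inj_re : forall k, k \is Num.real -> inj (re k) = k;
  inj_le : forall r s, (inj r <= inj s) = (r <= s);
  re_le_norm : forall k, inj `|re k| <= `|k|;
  unit_sphere_compact : forall th : nat -> K, (forall n, `|th n| = 1) ->
    exists2 sigma : nat -> nat, {homo sigma : m n / (m < n)%N} &
    exists2 t : K, `|t| = 1 & th (sigma n) @[n --> \oo] --> t;
  linear_lift : forall (Y : lmodType K) (u : restrict_scalars inj Y -> R),
    linear_functional u ->
    exists f : {linear Y -> K^o}, forall y, re (f y) = u y }.

Lemma linear_bundle (K : pzRingType) (U W : lmodType K) (h : U -> W) :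
  linear h -> exists f : {linear U -> W}, f =1 h.
Proof.
move=> lh; pose m := GRing.isLinear.Build K U W *:%R h lh.
by pose f : {linear U -> W} := HB.pack h m; exists f.
Qed.

Lemma phase (K : numFieldType) (k : K) : exists2 t, `|t| = 1 & t * k = `|k|.
Proof.
have [->|k0] := eqVneq k 0; first by exists 1; rewrite ?normr1// mulr0 normr0.
exists (`|k| / k); last by rewrite divfK.
by rewrite normf_div normr_id divff// normr_eq0.
Qed.

Section scalars.
Context (R : realType) (K : numFieldType) (inj : {rmorphism R -> K}) (re : K -> R).
Hypothesis H : real_or_complex inj re.

Lemma inj_lt r s : (inj r < inj s) = (r < s).
Proof.
rewrite !lt_neqAle (inj_le H); congr (~~ _ && _).
by apply/eqP/eqP => [e|->//]; rewrite -(re_inj H r) e (re_inj H).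
Qed.

Lemma inj_ge0 r : (0 <= inj r) = (0 <= r).
Proof. by rewrite -(inj_le H) rmorph0. Qed.

Lemma inj_gt0 r : (0 < inj r) = (0 < r).
Proof. by rewrite -inj_lt rmorph0. Qed.

Lemma inj_re_ge0 k : 0 <= k -> inj (re k) = k.
Proof. by move=> k0; rewrite (inj_re H)// ger0_real. Qed.

Lemma re_ge0 k : 0 <= k -> 0 <= re k.
Proof. by move=> k0; rewrite -inj_ge0 inj_re_ge0. Qed.

Lemma re_gt0 k : 0 < k -> 0 < re k.
Proof. by move=> k0; rewrite -inj_gt0 inj_re_ge0// ltW. Qed.

Lemma re_le a b : 0 <= a -> a <= b -> re a <= re b.
Proof.
by move=> a0 ab; rewrite -(inj_le H) !inj_re_ge0// (le_trans a0).
Qed.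

Lemma re0 : re 0 = 0.
Proof. by rewrite -(rmorph0 inj) (re_inj H). Qed.

Lemma reN a : re (- a) = - re a.
Proof. by apply/eqP; rewrite -subr_eq0 opprK -(re_add H) addNr re0. Qed.

Lemma inj_norm r : `|inj r| = inj `|r|.
Proof.
have [r0|r0] := leP 0 r; first by rewrite !ger0_norm ?inj_ge0.
by rewrite !ltr0_norm ?rmorphN// -(rmorph0 inj) inj_lt.
Qed.

Definition rnorm (Y : normedModType K) (y : Y) : R := re `|y|.

Lemma inj_rnorm (Y : normedModType K) (y : Y) : inj (rnorm y) = `|y|.
Proof. by rewrite inj_re_ge0. Qed.

Lemma rnorm_seminorm (Y : normedModType K) :
  seminorm_like (@rnorm Y : restrict_scalars inj Y -> R).
Proof.
split; last by move=> x; rewrite /rnorm normrN.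
split=> [x y|t x t0].
  by rewrite -(inj_le H) rmorphD /= !inj_rnorm ler_normD.
rewrite -(re_inj H (t * _)) rmorphM/= inj_rnorm {1}/rnorm.
by rewrite [t *: x]/(inj t *: (x : Y)) normrZ inj_norm ger0_norm.
Qed.

Lemma cvg_rnormP (Y : normedModType K) (y : nat -> Y) l :
  y n @[n --> \oo] --> l <->
  (forall e : R, 0 < e -> exists n0, forall n, (n0 <= n)%N -> rnorm (l - y n) < e).
Proof.
split=> [/cvgrPdist_lt yl e e0|yl].
  have [n0 _ h] := yl (inj e) ltac:(by rewrite inj_gt0).
  by exists n0 => n /h; rewrite /= -inj_rnorm inj_lt.
apply/cvgrPdist_lt => e e0; have [n0 h] := yl _ (re_gt0 e0).
by exists n0 => // n /h; rewrite /= -inj_lt inj_rnorm inj_re_ge0// ltW.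
Qed.

Lemma cauchy_rnorm_cvg (Y : completeNormedModType K) (y : nat -> Y) :
  (forall e : R, 0 < e -> exists n0, forall n m, (n0 <= n)%N -> (n0 <= m)%N ->
    rnorm (y n - y m) < e) -> exists l : Y, y n @[n --> \oo] --> l.
Proof.
move=> yc; exists (lim (y @ \oo)); apply: cauchy_cvg.
apply: cauchy_exP => e e0; have [n0 h] := yc _ (re_gt0 e0).
exists (y n0), n0 => // n /= n0n; rewrite -ball_normE /=.
by rewrite -inj_rnorm -[e]inj_re_ge0 ?ltW// inj_lt h.
Qed.

Lemma bounded_operatorP (X Y : normedModType K) (T : {linear X -> Y}) :
  bounded_operator T -> exists2 c : R, 0 <= c & forall x, `|T x| <= inj c * `|x|.
Proof.
(* When all norms vanish [M] may be any scalar, even a nonreal one, hence the passage to its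
   absolute value. *)
move=> [M TM]; exists (re `|M|) => [|x]; first exact: re_ge0.
rewrite inj_re_ge0//.
have Mx0 : 0 <= M * `|x| by exact: le_trans (TM x).
by apply: le_trans (TM x) _; rewrite -[leLHS]ger0_norm// normrM normr_id.
Qed.

Lemma bounded_operator_continuous (X Y : normedModType K) (T : {linear X -> Y}) :
  bounded_operator T -> continuous T.
Proof.
move=> /bounded_operatorP[c c0 Tc]; apply/linear_bounded_continuous.
apply/linear_boundedP; exists (inj c); split; first by rewrite realE inj_ge0 c0.
by move=> r cr x; apply: le_trans (Tc x) _; rewrite ler_wpM2r// ltW.
Qed.

(** At a rotation [t *: y] where [f] takes the value [|f y|], it agrees with its real part [u]; the
    bound on [u] thus holds for [f] with the same constant. *)
Lemma dual_lift (Y : normedModType K) (u : restrict_scalars inj Y -> R) c :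
  linear_functional u -> (forall y, `|u y| <= c * rnorm y) ->
  exists f : {linear Y -> K^o}, (forall y, re (f y) = u y) /\
    forall y, `|f y| <= inj c * `|y|.
Proof.
move=> lu uc; have [f fu] := linear_lift H lu; exists f; split=> // y.
have [t t1 tf] := phase (f y).
have fty : f (t *: y) = `|f y| :> K by rewrite linearZ.
have := uc (t *: y); rewrite -fu fty ger0_norm ?re_ge0//.
by rewrite -(inj_le H) rmorphM/= inj_rnorm inj_re_ge0// normrZ t1 mul1r.
Qed.

End scalars.

(** * Weak topology and weak compactness *)

Section weak_topology.
Context (R : realType) (K : numFieldType) (inj : {rmorphism R -> K}) (re : K -> R).
Hypothesis H : real_or_complex inj re.

(** A cluster point with [re (f p) > b] would have a neighbourhood that the sequence eventually
    avoids. The topology is left arbitrary to cover the norm and the weak one. *)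
Lemma compact_re_cluster (W : topologicalType) (C : set W) (y : nat -> W) :
  compact C -> (forall n, C (y n)) ->
  exists p, forall (f : W -> K^o) b, continuous f ->
    (exists n0, forall n, (n0 <= n)%N -> re (f (y n)) <= b) -> re (f p) <= b.
Proof.
move=> cC Cy; have [|p [_ py]] := cC (y @ \oo) _; first by exists 0%N => // n _ /=.
exists p => f b cf [n0 fyb]; rewrite leNgt; apply/negP => bfp.
have [] := py [set w | re (f w) <= b] (f @^-1` [set k | b < re k]).
- by exists n0.
- apply: cf; apply/nbhs_normP; exists (inj (re (f p) - b)) => /=.
    by rewrite (inj_gt0 H) subr_gt0.
  move=> k /= fpk; have := le_lt_trans (re_le_norm H _) fpk.
  by rewrite (inj_lt H) (re_add H) (reN H) ltr_norml => /andP[_]; lra.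
- by move=> w [/= h1 h2]; lra.
Qed.

Lemma weak_functional_continuous (Y : normedModType K) (f : {linear Y -> K^o}) :
  bounded_operator f -> continuous (f : weak_space Y -> K^o).
Proof.
move=> bf y U fU; pose d : dual Y := exist _ f bf.
have yd : nbhs (y : weak_space Y) --> (y : initial_topology (sval d : Y -> K^o)).
  pose Tc (g : dual Y) := Topological.on (initial_topology (sval g : Y -> K^o)).
  have yy : nbhs (y : weak_space Y) --> (y : sup_topology Tc) by move=> A; exact.
  exact: ((@cvg_sup Y _ Tc _ y (@nbhs_filter (weak_space Y) y)).1 yy d).
apply: yd; exact: (@initial_continuous _ _ (sval d : Y -> K^o) y U fU).
Qed.

Lemma weak_space_continuous (Y : normedModType K) (W : topologicalType)
    (h : W -> weak_space Y) :
  (forall f : dual Y, continuous (fun w => sval f (h w) : K^o)) -> continuous h.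
Proof.
move=> hf w; have hw : Filter (h @ w) by exact: fmap_filter.
pose Tc (g : dual Y) := Topological.on (initial_topology (sval g : Y -> K^o)).
apply: (@cvg_sup Y _ Tc _ (h w) hw).2 => d.
exact: (@continuous_comp_initial _ _ _ (sval d : Y -> K^o)
  (h : W -> initial_topology (sval d : Y -> K^o)) (hf d)).
Qed.

(** A functional norming [p - q] takes equal values at points that cannot be separated, so [p - q]
    has norm 0. *)
Lemma weak_space_hausdorff (Y : normedModType K) : hausdorff_space (weak_space Y).
Proof.
move=> p q pq; have sN := rnorm_seminorm H Y.
have [u [lu uN upq]] := norming_functional sN ((p : Y) - (q : Y)).
have u1 y : `|u y| <= 1 * rnorm re y by rewrite mul1r.
have [f [fu fN]] := dual_lift H lu u1.
have bf : bounded_operator f by exists (inj 1).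
have fpq : f p = f q.
  apply: (@norm_hausdorff _ K^o) => A B Ap Bq.
  have [w [/= Aw Bw]] := pq _ _ (weak_functional_continuous bf Ap)
    (weak_functional_continuous bf Bq).
  by exists (f w).
apply/eqP; rewrite -subr_eq0 -normr_eq0 -(inj_rnorm H) -upq -fu linearB/= fpq.
by rewrite subrr (re0 H) rmorph0.
Qed.

Lemma precompact_image (W : topologicalType) (A : W -> W) (C : set W) :
  hausdorff_space W -> continuous A -> precompact C -> precompact (A @` C).
Proof.
move=> hW cA; rewrite precompactE => cC.
apply: (@precompact_subset _ _ (A @` closure C)).
  by apply: image_subset; exact: subset_closure.
apply: compact_precompact => //; apply: continuous_compact => //.
exact: continuous_subspaceT.
Qed.

(** * Cluster points and compositions of compact and weakly compact operators *)

Section operators.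
Context (X Y : normedModType K).
Implicit Type T : {linear X -> Y}.

Let ball_image T : set (restrict_scalars inj Y) := T @` unit_ball X.

Lemma compact_operator_cluster T : compact_operator T ->
  weak_cluster_property (@rnorm R K re Y : restrict_scalars inj Y -> R)
    (ball_image T).
Proof.
move=> [_ +] y yT; rewrite precompactE => cT.
have [n|p pP] := @compact_re_cluster Y _ y cT.
  by apply: subset_closure; exact: yT.
exists p => g b [lg [c gc]] gb; have [f [fg fN]] := dual_lift H lg gc.
rewrite -fg; apply: pP; last by case: gb => n0 h; exists n0 => n /h; rewrite fg.
by apply: (bounded_operator_continuous H); exists (inj c).
Qed.

Lemma weakly_compact_operator_cluster T : weakly_compact_operator T ->
  weak_cluster_property (@rnorm R K re Y : restrict_scalars inj Y -> R)
    (ball_image T).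
Proof.
move=> [_ +] y yT; rewrite precompactE => cT.
have [n|p pP] := @compact_re_cluster (weak_space Y) _ y cT.
  by apply: subset_closure; exact: yT.
exists p => g b [lg [c gc]] gb; have [f [fg fN]] := dual_lift H lg gc.
rewrite -fg; apply: pP; last by case: gb => n0 h; exists n0 => n /h; rewrite fg.
by apply: weak_functional_continuous; exists (inj c).
Qed.

Lemma bounded_operator_comp T (A : {linear Y -> Y}) :
  bounded_operator T -> bounded_operator A ->
  bounded_operator (A \o T : {linear X -> Y}).
Proof.
move=> /(bounded_operatorP H)[c c0 Tc] /(bounded_operatorP H)[d d0 Ad].
exists (inj d * inj c) => x /=; apply: le_trans (Ad _) _.
by rewrite -mulrA ler_wpM2l// (inj_ge0 H).
Qed.

Lemma compact_operator_comp T (A : {linear Y -> Y}) :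
  bounded_operator A -> compact_operator T ->
  compact_operator (A \o T : {linear X -> Y}).
Proof.
move=> bA [bT cT]; split; first exact: bounded_operator_comp.
rewrite -(image_comp T A); apply: (@precompact_image Y A) => //.
exact: (bounded_operator_continuous H bA).
Qed.

Lemma weakly_compact_operator_comp T (A : {linear Y -> Y}) :
  bounded_operator A -> weakly_compact_operator T ->
  weakly_compact_operator (A \o T : {linear X -> Y}).
Proof.
move=> bA [bT cT]; split; first exact: bounded_operator_comp.
rewrite -(image_comp T A).
apply: (@precompact_image (weak_space Y) A) => //.
  exact: weak_space_hausdorff.
apply: weak_space_continuous => -[f bf] /=.
have bfA : bounded_operator (f \o A : {linear Y -> K^o}).
  move: bf bA => /(bounded_operatorP H)[c c0 fc] /(bounded_operatorP H)[d d0 Ad].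
  exists (inj c * inj d) => y /=; apply: le_trans (fc _) _.
  by rewrite -mulrA ler_wpM2l// (inj_ge0 H).
exact: (weak_functional_continuous bfA).
Qed.

End operators.

End weak_topology.

(** * Perturbation of operators *)

Section operator_norm.
Context (R : realType) (K : numFieldType) (inj : {rmorphism R -> K}) (re : K -> R).
Hypothesis H : real_or_complex inj re.
Context (X Y : normedModType K).
Implicit Type T : X -> Y.

Lemma unit_ball0 : unit_ball X 0.
Proof. by rewrite /unit_ball /= normr0 ler01. Qed.

(** [supremum] chooses a least upper bound, unique by antisymmetry. Every upper bound is
    nonnegative, hence in the image of [inj], and the comparison takes place in [R]. *)
Lemma opnormE T c : (forall x, unit_ball X x -> rnorm re (T x) <= c) ->
  (forall e, 0 < e -> exists2 x, unit_ball X x & c - e <= rnorm re (T x)) ->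
  opnorm T = inj c.
Proof.
move=> Tc cT; rewrite /opnorm /supremum.
case: eqP => [A0|_].
  have : [set `|T x| | x in unit_ball X] `|T 0| by exists 0 => //; exact: unit_ball0.
  by rewrite A0.
apply: xget_subset1.
  split=> [_ [x x1 <-]|b bT]; first by rewrite -(inj_rnorm H) (inj_le H) Tc.
  have Tb x : unit_ball X x -> `|T x| <= b by move=> x1; apply: bT; exists x.
  have b0 : 0 <= b by exact: le_trans (Tb 0 unit_ball0).
  rewrite -(inj_re_ge0 H b0) (inj_le H); apply/ler_addgt0Pl => e e0.
  have [x x1 cx] := cT e e0.
  by have := re_le H (normr_ge0 _) (Tb x x1); rewrite /rnorm in cx; lra.
by move=> a b [a1 a2] [b1 b2]; apply/eqP; rewrite eq_le a2//= b2.
Qed.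

Lemma opnorm_le T c : (forall x, unit_ball X x -> rnorm re (T x) <= c) ->
  opnorm T <= inj c.
Proof.
move=> Tc; pose E := [set rnorm re (T x) | x in unit_ball X].
have E0 : E !=set0 by exists (rnorm re (T 0)), 0 => //; exact: unit_ball0.
have Ec : ubound E c by move=> _ [x x1 <-]; exact: Tc.
rewrite (@opnormE _ (sup E)) ?(inj_le H); first exact: ge_sup.
  by move=> x x1; apply: ub_le_sup; [exists c|exists x].
move=> e e0; have [|_ [x x1 <-] h] := @sup_adherent R E e e0.
  by split=> //; exists c.
by exists x => //; exact: ltW.
Qed.

End operator_norm.

Section perturbation.
Context (R : realType) (K : numFieldType) (inj : {rmorphism R -> K}) (re : K -> R).
Hypothesis H : real_or_complex inj re.
Context (X : normedModType K) (Y : completeNormedModType K).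

(* [A y = y + f y *: w], where [w] is [l / `|l|] times the phase making
   [`|A l|] maximal (and [w = 0] if [l = 0]). *)
Lemma stretching_map (f : {linear Y -> K^o}) (l : Y) (e : R) : 0 <= e ->
  (forall y, `|f y| <= inj e * `|y|) ->
  exists A : {linear Y -> Y}, [/\ forall y, `|A y - y| <= `|f y|,
    forall y, rnorm re (A y) <= (1 + e) * rnorm re y &
    rnorm re (A l) = rnorm re l + re `|f l|].
Proof.
move=> e0 fe; have [t t1 tfl] := phase (f l).
pose w : Y := (t / `|l|) *: l.
have w1 : `|w| <= 1.
  rewrite normrZ normf_div t1 normr_id mul1r.
  have [->|l0] := eqVneq l 0; first by rewrite normr0 mulr0.
  by rewrite mulVf// normr_eq0.
have [|A AE] := @linear_bundle K Y Y (fun y => y + (f y : K) *: w).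
  move=> a x y; rewrite linearP scalerDr scalerDl addrACA.
  by rewrite -[(a *: f x) *: w]/((a * f x) *: w) -(scalerA a (f x : K)).
have Af y : `|A y - y| <= `|f y|.
  rewrite AE addrAC subrr add0r normrZ -[leRHS]mulr1; exact: ler_wpM2l.
exists A; split=> // [y|].
  rewrite -(inj_le H) rmorphM rmorphD rmorph1 !(inj_rnorm H) -[A y](subrK y).
  apply: le_trans (ler_normD _ _) _; rewrite mulrDl mul1r addrC lerD2l.
  exact: le_trans (Af y) (fe y).
rewrite /rnorm -(re_add H) AE; congr re.
have [l0|l0] := eqVneq l 0.
  by rewrite /w l0 linear0 scale0r addr0 !normr0 addr0.
have -> : l + (f l : K) *: w = (1 + `|f l| / `|l|) *: l.
  by rewrite /w scalerA mulrA [X in X / _]mulrC tfl scalerDl scale1r.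
rewrite normrZ ger0_norm ?addr_ge0 ?divr_ge0// mulrDl mul1r divfK//.
by rewrite normr_eq0.
Qed.

Lemma uniquely_quasi_attaining_perturbation (T : {linear X -> Y}) (e : K) :
  bounded_operator T ->
  weak_cluster_property (@rnorm R K re Y : restrict_scalars inj Y -> R)
    (T @` unit_ball X) ->
  0 < e ->
  exists A : {linear Y -> Y}, [/\ bounded_operator A,
    uniquely_quasi_attains_norm (A \o T : {linear X -> Y}) &
    opnorm (T \- (A \o T)) < e].
Proof.
move=> /(bounded_operatorP H)[c c0 Tc] Tweak e0.
pose V := restrict_scalars inj Y; pose N : V -> R := @rnorm R K re Y.
have sN : seminorm_like N := rnorm_seminorm H Y.
pose D : set V := T @` unit_ball X.
have D0 : D !=set0 by exists (T 0), 0 => //; exact: unit_ball0.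
have DM y : D y -> N y <= c.
  move=> [x x1 <-]; rewrite -(inj_le H) (inj_rnorm H).
  apply: le_trans (Tc x) _; rewrite -[leRHS]mulr1 ler_wpM2l// (inj_ge0 H)//.
have c1 : 0 < 2 * (c + 1) by rewrite mulr_gt0// ltr_wpDl.
(* The perturbation has norm at most [d * c], which this choice keeps below [e]. *)
pose d := re e / (2 * (c + 1)).
have d0 : 0 < d by rewrite divr_gt0// (re_gt0 H).
(* Here [phi] is the norm [N] itself; [u] will be the real part of a [K]-linear [f]. *)
have [u [lu ud su]] := stegall sN D0 DM DM Tweak d0.
have [f [fu fd]] := dual_lift H lu ud.
have bu : bounded_functional N u by split=> //; exists d.
pose h := support D N u.
have Drot t y : `|t| = 1 -> D y -> D (t *: (y : Y)).
  move=> t1 [x x1 <-]; exists (t *: x); last by rewrite linearZ.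
  by rewrite /unit_ball /= normrZ t1 mul1r.
have rot t (y : Y) : `|t| = 1 -> t * f y = `|f y| ->
    N (t *: y) + u (t *: y) = N y + re `|f y|.
  move=> t1 tfy; rewrite -fu linearZ /= -tfy; congr (_ + _).
  by rewrite /N /rnorm normrZ t1 mul1r.
have Nfh (y : Y) : D y -> N y + re `|f y| <= h.
  move=> Dy; have [t t1 tfy] := phase (f y); rewrite -(rot t)//.
  by apply: (support_ge sN DM DM bu); exact: Drot.
have /choice[y yP] : forall n : nat, exists y, slice D N u n.+1%:R^-1 y.
  by move=> n; apply: (slice_nonempty sN D0 DM DM bu); rewrite invr_gt0.
have yslice (eta : R) : 0 < eta ->
    exists n0, forall n, (n0 <= n)%N -> slice D N u eta (y n).
  move=> eta0; exists (Num.bound eta^-1) => n en; have [Dy hy] := yP n.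
  split=> //; apply: le_lt_trans hy; rewrite lerD2l lerN2.
  rewrite invf_ple ?posrE//; apply: ltW; apply: lt_le_trans (archi_boundP _) _.
    by rewrite invr_ge0 ltW.
  by rewrite ler_nat ltnW.
(* Arbitrarily small slices make [y] a Cauchy sequence; in general [l] only lies in the closure of
   [D]. *)
have [l yl] : exists l : Y, (y : nat -> Y) n @[n --> \oo] --> l.
  apply: (cauchy_rnorm_cvg H) => r r0.
  have [eta eta0 he] := su (r / 2) ltac:(by rewrite divr_gt0).
  have [n0 hn] := yslice eta eta0; exists n0 => n m nn nm.
  have := he _ _ (hn n nn) (hn m nm); rewrite -/N /= => le2.
  by apply: le_lt_trans le2 _; lra.
have ylP := (cvg_rnormP H (y : nat -> Y) l).1 yl.
have strong r : 0 < r -> exists2 eta, 0 < eta &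
    forall z : Y, slice D N u eta z -> N (l - z) <= r.
  move=> r0; have [eta eta0 he] := su (r / 2) ltac:(by rewrite divr_gt0).
  exists eta => // z sz; have [n0 hn] := yslice eta eta0.
  have [n1 hn1] := ylP (r / 2) ltac:(by rewrite divr_gt0).
  have := he _ _ (hn (maxn n0 n1) (leq_maxl _ _)) sz.
  have := hn1 (maxn n0 n1) (leq_maxr _ _).
  have := seminorm_triangle sN (y (maxn n0 n1)) (l : V) z.
  by rewrite /N /=; lra.
have [A [Af Ad Al]] := stretching_map l (ltW d0) fd.
have AN (z : Y) : D z -> N (A z) <= N z + re `|f z|.
  move=> Dz; rewrite -(inj_le H) rmorphD/= !(inj_rnorm H).
  by rewrite -[A z](subrK z) addrC; apply: le_trans (ler_normD _ _) _; rewrite lerD2l.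
have NC (a b : Y) : N (a - b) = N (b - a) by exact: (seminormB sN).
have Nlip (a b : Y) : N a <= N b + N (a - b).
  by have := sN.1.1 (b : V) (a - b); rewrite addrC subrK.
have uN (v : V) : u (- v) = - u v by rewrite -scaleN1r lu.2 mulN1r.
have ulip (a b : Y) : u a <= u b + d * N (a - b).
  have := ud ((a : V) - b); rewrite lu.1 uN.
  by move=> /(le_trans (ler_norm _)); rewrite lerBlDl.
have hAl : h <= N (A l).
  apply/ler_addgt0Pl => r r0; rewrite [N _]Al.
  have d2 : 0 < 2 + d by rewrite addr_gt0.
  (* One [q] is lost for the slice and [(1 + d) * q] for passing from [z] to [l] in [N + u]. *)
  pose q := r / (2 + d); have r0' : 0 < q by rewrite divr_gt0.
  have qr : (2 + d) * q = r by rewrite mulrC divfK// gt_eqF.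
  have [n0 hn0] := yslice _ r0'; have [n1 hn1] := ylP _ r0'.
  have [Dy hy] := hn0 _ (leq_maxl n0 n1).
  have := hn1 _ (leq_maxr n0 n1).
  move: (y (maxn n0 n1)) Dy hy => z Dz hz lz.
  have ul : u l <= re `|f l|.
    have := re_le_norm H (f l); rewrite fu -{1}(inj_re_ge0 H (normr_ge0 (f l))).
    by rewrite (inj_le H) => /(le_trans (ler_norm _)).
  have := ulip z l; have := Nlip z l; rewrite [N (z - l)]NC.
  have lzq : (1 + d) * N (l - z) <= (1 + d) * q by rewrite ler_wpM2l ?addr_ge0// ltW.
  move: hz lzq; rewrite -/h /N => *; clearbody q; lra.
have AB (z z' : Y) : N (A z - A z') <= (1 + d) * N (z - z').
  by rewrite -linearB; exact: Ad.
have bA : bounded_operator A.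
  exists (inj (1 + d)) => z; rewrite -!(inj_rnorm H) -rmorphM/= (inj_le H).
  exact: Ad.
have cA := bounded_operator_continuous H bA.
exists A; split=> //; last first.
  apply: (@le_lt_trans _ _ (inj (d * c))).
    apply: (opnorm_le H) => x x1 /=; rewrite -(inj_le H) (inj_rnorm H) distrC.
    apply: le_trans (Af _) _; apply: le_trans (fd _) _.
    rewrite rmorphM/= ler_wpM2l ?(inj_ge0 H) ?(ltW d0)//.
    by rewrite -(inj_rnorm H) (inj_le H) DM//; exists x.
  rewrite -(inj_re_ge0 H (ltW e0)) (inj_lt H) /d mulrAC ltr_pdivrMr//.
  by rewrite ltr_pM2l ?(re_gt0 H)//; lra.
have opS : opnorm (A \o T) = inj h.
  apply: (opnormE H) => [x x1|r r0] /=.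
    have Dx : D (T x) by exists x.
    exact: le_trans (AN _ Dx) (Nfh _ Dx).
  have [n0 hn0] := ylP (r / (1 + d)) ltac:(by rewrite divr_gt0// addr_gt0).
  have [[x x1 Tx] _] := yP n0; exists x => //; rewrite Tx.
  have := hn0 _ (leqnn _); have := AB l (y n0).
  have := seminorm_triangle sN (A (y n0) : V) (A l : V) 0; rewrite !subr0.
  rewrite /N ltr_pdivlMr ?addr_gt0//; rewrite /N in hAl.
  by rewrite [_ * (1 + d)]mulrC; lra.
exists (A l) => x x1; rewrite /= opS => /cvgrPdist_lt xh.
(* After rotation by [t n] the points [T (x n)] nearly maximize [N + u], so they converge to [l].
   The inverse phases converge along a subsequence, by compactness of the unit sphere of [K]. *)
have /choice[t tP] : forall n, exists t : K, `|t| = 1 /\ t * f (T (x n)) = `|f (T (x n))|.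
  by move=> n; have [t t1 tf] := phase (f (T (x n))); exists t.
have tu n : `|(t n)^-1| = 1 by rewrite normfV (tP n).1 invr1.
have [sigma sh [s s1 ts]] := unit_sphere_compact H tu.
exists sigma => //; exists s => //.
have zl : (t n *: T (x n)) @[n --> \oo] --> l.
  apply/(cvg_rnormP H) => r r0.
  have [eta eta0 he] := strong (r / 2) ltac:(by rewrite divr_gt0).
  have [n0 _ hn0] := xh (inj eta) ltac:(by rewrite (inj_gt0 H)).
  exists n0 => n nn; apply: (@le_lt_trans _ _ (r / 2)); last by lra.
  apply: he; have Dx : D (T (x n)) by exists (x n).
  split; first by apply: Drot => //; exact: (tP n).1.
  rewrite (rot _ _ (tP n).1 (tP n).2).
  have := hn0 n nn; rewrite /= -(inj_rnorm H) -rmorphB (inj_norm H) (inj_lt H).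
  by rewrite ltr_norml => /andP[_]; have := AN _ Dx; rewrite /N /h /=; lra.
have sn n : (n <= sigma n)%N.
  by elim: n => // n IH; apply: leq_ltn_trans IH _; exact: sh.
have zsl : (t (sigma n) *: T (x (sigma n))) @[n --> \oo] --> l.
  apply/(cvg_rnormP H) => r r0; have [n0 hn0] := (cvg_rnormP H _ _).1 zl r r0.
  by exists n0 => n nn; apply: hn0; exact: leq_trans nn (sn n).
rewrite -linearZ /=.
have -> : (fun n => A (T (x (sigma n)))) =
    (fun n => A ((t (sigma n))^-1 *: (t (sigma n) *: T (x (sigma n))))).
  apply/funext => n; rewrite scalerA mulVf ?scale1r// -normr_gt0 (tP _).1 ltr01//.
exact: (cvg_comp _ A (cvgZ ts zsl) (cA _)).
Qed.

End perturbation.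

(** * The real and the complex numbers as scalar fields *)

Section scalar_instances.
Context (R : realType).

Lemma bounded_subsequence (a : nat -> R) : (forall n, `|a n| <= 1) ->
  exists2 sigma : nat -> nat, {homo sigma : m n / (m < n)%N} &
  exists l : R, a (sigma n) @[n --> \oo] --> l.
Proof.
move=> a1; have [|l [_ al]] := @segment_compact R (-1) 1 (a @ \oo) _.
  by exists 0%N => // n _ /=; rewrite in_itv/= -ler_norml.
(* [nxt (m, k)] is an index from [m] on at which the sequence is within [k.+1%:R^-1] of the cluster
   point [l]. *)
have /choice[nxt nxtP] : forall mk : nat * nat, exists n,
    (mk.1 <= n)%N /\ `|l - a n| < mk.2.+1%:R^-1.
  move=> [m k]; have k0 : 0 < k.+1%:R^-1 :> R by rewrite invr_gt0.
  have [|_ [[n mn <-] ln]] := al (a @` [set n | (m <= n)%N]) _ _ (nbhsx_ballx l _ k0).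
    by exists m => // n mn; exists n.
  by exists n; split=> //; move: ln; rewrite -ball_normE.
pose fix sigma n := if n is k.+1 then nxt ((sigma k).+1, k.+1) else nxt (0, 0)%N.
have sS n : (sigma n < sigma n.+1)%N by have [] := nxtP ((sigma n).+1, n.+1).
have sl n : `|l - a (sigma n)| < n.+1%:R^-1.
  by case: n => [|n]; [have [] := nxtP (0, 0)%N|have [] := nxtP ((sigma n).+1, n.+1)].
exists sigma; first by apply: homo_ltn => // ? ? ?; exact: ltn_trans.
exists l; apply/cvgrPdist_lt => e e0.
exists (Num.bound e^-1) => // n /= en; apply: lt_trans (sl n) _.
rewrite invf_plt ?posrE//; apply: lt_le_trans (archi_boundP _) _.
  by rewrite invr_ge0 ltW.
by rewrite ler_nat ltnW.
Qed.

Lemma cvg_unit (K : numFieldType) (th : nat -> K) t :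
  (forall n, `|th n| = 1) -> th n @[n --> \oo] --> t -> `|t| = 1.
Proof.
move=> th1 tht; apply: (cvg_unique (@norm_hausdorff _ K^o) (F := `|th n| @[n --> \oo])).
  exact: cvg_norm.
have -> : (fun n => `|th n|) = fun=> 1 by apply/funext.
exact: cvg_cst.
Qed.

Lemma real_scalars : @real_or_complex R R idfun idfun.
Proof.
split=> //.
  move=> th th1.
  have [n|sigma sh [t tht]] := @bounded_subsequence th; first by rewrite th1.
  by exists sigma => //; exists t => //; exact: cvg_unit tht.
move=> Y u [uD uZ]; have [|f fu] := @linear_bundle R Y R^o u; last by exists f.
by move=> a x y; rewrite uD [u (a *: _)]uZ.
Qed.

Lemma normc_ge_Im (z : R[i]) : `|complex.Im z|%:C <= `|z|.
Proof.
by case: z => a b; simpc; rewrite -sqrtr_sqr ler_wsqrtr // lerDr sqr_ge0.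
Qed.

Lemma normc_le_ReIm (z : R[i]) :
  `|z| <= (`|complex.Re z| + `|complex.Im z|)%:C.
Proof.
case: z => a b; rewrite normc_def lecR /=.
rewrite -[leRHS]ger0_norm ?addr_ge0// -sqrtr_sqr ler_wsqrtr//.
rewrite sqrrD !real_normK ?num_real//.
have := mulr_ge0 (normr_ge0 a) (normr_ge0 b); lra.
Qed.

Lemma complex_scalars :
  @real_or_complex R R[i] (real_complex R) (@complex.Re R).
Proof.
split=> //.
- by move=> [? ?] [? ?].
- exact: RRe_real.
- exact: lecR.
- exact: normc_ge_Re.
- move=> th th1; pose a n := complex.Re (th n); pose b n := complex.Im (th n).
  have a1 n : `|a n| <= 1.
    by rewrite -lecR; apply: le_trans (normc_ge_Re _) _; rewrite th1.
  have b1 n : `|b n| <= 1.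
    by rewrite -lecR; apply: le_trans (normc_ge_Im _) _; rewrite th1.
  have [s sh [la aP]] := bounded_subsequence a1.
  have [s' s'h [lb bP]] := bounded_subsequence (fun n => b1 (s n)).
  have s'n n : (n <= s' n)%N.
    by elim: n => // n IH; apply: leq_ltn_trans IH _; exact: s'h.
  pose K : numFieldType := R[i].
  have thP : ((fun n => th (s (s' n))) : nat -> K) n @[n --> \oo] --> (la +i* lb : K).
    apply/cvgrPdist_lt => e e0; have eR : (complex.Re e)%:C = e.
      by apply: RRe_real; rewrite gtr0_real.
    have e'0 : 0 < complex.Re e / 2 by rewrite divr_gt0// -ltcR eR.
    move/cvgrPdist_lt : aP => /(_ _ e'0)[n0 _ h0].
    move/cvgrPdist_lt : bP => /(_ _ e'0)[n1 _ h1].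
    exists (maxn n0 n1) => // n /=; rewrite geq_max => /andP[nn0 nn1].
    apply: le_lt_trans (normc_le_ReIm _) _; rewrite -eR ltcR.
    have := h0 (s' n) (leq_trans nn0 (s'n n)); have := h1 n nn1.
    by rewrite /= /a /b; case: (th _) => x y /=; lra.
  exists (s \o s'); first by move=> m n /s'h/sh.
  by exists (la +i* lb) => //; exact: cvg_unit thP.
- move=> Y u [uD uZ].
  have uZ' (r : R) (y : Y) : u (r%:C *: y) = r * u y by exact: uZ.
  have uC (z : R[i]) (y : Y) :
      u (z *: y) = complex.Re z * u y + complex.Im z * u ('i *: y).
    by rewrite {1}[z]complexE ['i * _]mulrC scalerDl uD -scalerA !uZ'.
  (* Complex linearity dictates the imaginary part, since the real part of ['i * f y] is minus the
     imaginary part of [f y]. *)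
  have [|f fE] := @linear_bundle R[i] Y R[i]^o (fun y => u y +i* - u ('i *: y)).
    have uii (x : Y) : u ('i *: ('i *: x)) = - u x.
      rewrite scalerA -expr2 sqr_i -(rmorphN1 (real_complex R)) uZ'.
      by rewrite mulN1r.
    move=> z x y; rewrite scalerDr !uD scalerA ['i * z]mulrC -scalerA.
    rewrite [u (z *: x)]uC [u (z *: ('i *: x))]uC uii.
    move: (u x) (u ('i *: x)) (u y) (u ('i *: y)) => p q r s.
    case: z => a b /=; rewrite /GRing.scale /=; simpc.
    by congr (_ +i* _); ring.
  by exists f => y; rewrite fE.
Qed.

End scalar_instances.

(** * Density in the compact and in the weakly compact operators *)

Lemma compact_and_weakly_compact_density (R : realType) (K : numFieldType)
    (inj : {rmorphism R -> K}) (re : K -> R) (X Y : completeNormedModType K) :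
  real_or_complex inj re ->
  opnorm_dense
    [set T : {linear X -> Y} |
      compact_operator T /\ uniquely_quasi_attains_norm T]
    [set T : {linear X -> Y} | compact_operator T]
  /\
  opnorm_dense
    [set T : {linear X -> Y} |
      weakly_compact_operator T /\ uniquely_quasi_attains_norm T]
    [set T : {linear X -> Y} | weakly_compact_operator T].
Proof.
move=> H; split; split=> [T []//|T cT e e0].
  have [A [bA uA TA]] := uniquely_quasi_attaining_perturbation H cT.1
    (compact_operator_cluster H cT) e0.
  by exists (A \o T) => //; split=> //; exact: (compact_operator_comp H).
have [A [bA uA TA]] := uniquely_quasi_attaining_perturbation H cT.1
  (weakly_compact_operator_cluster H cT) e0.
by exists (A \o T) => //; split=> //; exact: (weakly_compact_operator_comp H).
Qed.

Theorem corollary3p11 (R : realType) :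
  (forall X Y : completeNormedModType R,
     opnorm_dense
       [set T : {linear X -> Y} |
         compact_operator T /\ uniquely_quasi_attains_norm T]
       [set T : {linear X -> Y} | compact_operator T]
     /\
     opnorm_dense
       [set T : {linear X -> Y} |
         weakly_compact_operator T /\ uniquely_quasi_attains_norm T]
       [set T : {linear X -> Y} | weakly_compact_operator T])
  /\
  (forall X Y : completeNormedModType R[i],
     opnorm_dense
       [set T : {linear X -> Y} |
         compact_operator T /\ uniquely_quasi_attains_norm T]
       [set T : {linear X -> Y} | compact_operator T]
     /\
     opnorm_dense
       [set T : {linear X -> Y} |
         weakly_compact_operator T /\ uniquely_quasi_attains_norm T]
       [set T : {linear X -> Y} | weakly_compact_operator T]).
Proof.
split=> X Y; apply: compact_and_weakly_compact_density.
  exact: real_scalars.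
exact: complex_scalars.
Qed.
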